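(* Let $(M,\varphi,\xi,\eta,g)$ be a $(2n+1)$-dimensional almost contact manifold with Norden metric which belongs to the class $\mathcal{F}_{11}$. Then $$\|\nabla\varphi\|^2=-\|N\|^2=-2\|\nabla\eta\|^2=2\,\omega(\Omega).$$
   Context: Let $M$ be a smooth manifold of dimension $2n+1$. An almost contact structure $(\varphi,\xi,\eta)$ on $M$ consists of an endomorphism $\varphi$ of the tangent bundle, a vector field $\xi$ and a 1-form $\eta$ with $\varphi^2=-\mathrm{Id}+\eta\otimes\xi$ and $\eta(\xi)=1$. A pseudo-Riemannian metric $g$ on $M$ is a Norden metric ($B$-metric) if $g(\varphi x,\varphi y)=-g(x,y)+\eta(x)\eta(y)$ for all vector fields $x,y$; then $(M,\varphi,\xi,\eta,g)$ is called an almost contact manifold with Norden metric. (It follows that $\varphi\xi=0$, $\eta\circ\varphi=0$, $\eta(x)=g(x,\xi)$, $g(\varphi x,y)=g(x,\varphi y)$, and $g$ has signature $(n+1,n)$.) Let $\nabla$ be the Levi-Civita connection of $g$ and put $F(x,y,z)=g((\nabla_x\varphi)y,z)$. Define the 1-form $\omega(x)=F(\xi,\xi,x)$ and let $\Omega$ be the vector field with $\omega(x)=g(x,\Omega)$. The manifold belongs to the class $\mathcal{F}_{11}$ (is an $\mathcal{F}_{11}$-manifold) if $F(x,y,z)=\eta(x)\{\eta(y)\omega(z)+\eta(z)\omega(y)\}$ for all vector fields $x,y,z$. The Nijenhuis tensor of the almost contact structure is $$N(x,y)=\varphi^2[x,y]+[\varphi x,\varphi y]-\varphi[\varphi x,y]-\varphi[x,\varphi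 y]+\big((\nabla_x\eta)y\big)\xi-\big((\nabla_y\eta)x\big)\xi .$$ Square norms: with respect to any basis $\{e_i\}$ of the whole tangent space $T_pM$ (all $2n+1$ basis vectors, including the $\xi$-direction), with $(g^{ij})$ the inverse of the matrix $(g(e_i,e_j))$ and summation over repeated indices, $\|\nabla\varphi\|^2=g^{ij}g^{ks}g\big((\nabla_{e_i}\varphi)e_k,(\nabla_{e_j}\varphi)e_s\big)$, $\|\nabla\eta\|^2=g^{ij}g^{ks}\,(\nabla_{e_i}\eta)e_k\,(\nabla_{e_j}\eta)e_s$, and $\|N\|^2=g^{ij}g^{ks}g\big(N(e_i,e_k),N(e_j,e_s)\big)$. These may be zero or negative since $g$ is indefinite. *)

(* Defs.v *)
From HB Require Import structures.
From mathcomp Require Import all_boot all_order all_algebra.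
From mathcomp Require Import all_classical all_reals all_analysis.
From mathcomp Require Import ring.

Set Implicit Arguments.
Unset Strict Implicit.
Unset Printing Implicit Defensive.

Import Order.TTheory GRing.Theory Num.Theory.
Import numFieldNormedType.Exports.

Local Open Scope classical_set_scope.
Local Open Scope ring_scope.

Section SmoothEuclidean.
Context {R : realType} {m : nat}.
Implicit Types (U : set 'rV[R]_m) (f g : 'rV[R]_m -> R).

Definition unit_vec (i : 'I_m) : 'rV[R]_m := delta_mx 0 i.

(* f is of class C^k on U, through iterated partial derivatives. U is meant to
   be open: only then does this depend on the restriction of f to U alone. *)
Fixpoint Ck (k : nat) U f : Prop :=
  if k is k'.+1 then
    (forall x, U x -> {for x, continuous f}) /\
    forall i, (forall x, U x -> derivable f x (unit_vec i)) /\
              Ck k' U (fun x => 'D_(unit_vec i) f x)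
  else forall x, U x -> {for x, continuous f}.

Definition Cinfty U f := forall k, Ck k U f.

Lemma Ck_S k U f : Ck k.+1 U f -> Ck k U f.
Proof.
elim: k f => [|k IH] f /=; first by case.
case=> cf h; split=> // i; have [df h'] := h i; split=> //.
exact: IH.
Qed.

Lemma Ck_eq k U f g : open U -> (forall x, U x -> f x = g x) ->
  Ck k U f -> Ck k U g.
Proof.
move=> oU.
have eq_near f' g' x : (forall x, U x -> f' x = g' x) -> U x ->
    \forall y \near x, f' y = g' y.
  by move=> fg Ux; apply: filterS (open_nbhs_nbhs (conj oU Ux)).
have eq_cont f' g' : (forall x, U x -> f' x = g' x) ->
    (forall x, U x -> {for x, continuous f'}) ->
    forall x, U x -> {for x, continuous g'}.
  move=> fg cf x Ux; rewrite /prop_for /continuous_at -(fg x Ux).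
  exact: cvg_trans (near_eq_cvg (eq_near _ _ _ fg Ux)) (cf x Ux).
elim: k f g => [|k IH] f g fg; first exact: eq_cont.
case=> cf h; split; first exact: eq_cont cf.
move=> i; have [df hf] := h i; split.
  by move=> x Ux; apply: near_eq_derivable (df x Ux); exact: eq_near.
by apply: IH hf => x Ux; apply: near_eq_derive; exact: eq_near.
Qed.

Lemma Ck_continuous k U f : Ck k U f -> forall x, U x -> {for x, continuous f}.
Proof. by case: k => [|k] //= []. Qed.

Lemma CkD k U f g : open U -> Ck k U f -> Ck k U g -> Ck k U (f + g).
Proof.
move=> oU; elim: k f g => [|k IH] f g cf cg.
  by move=> x Ux; apply: continuousD; [apply: cf|apply: cg].
split.
  by move=> x Ux; apply: continuousD;
    [apply: (Ck_continuous cf)|apply: (Ck_continuous cg)].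
case: cf cg => _ hf [_ hg] i; have [df hf'] := hf i; have [dg hg'] := hg i.
split; first by move=> x Ux; apply: derivableD; [apply: df|apply: dg].
apply: (Ck_eq oU _ (IH _ _ hf' hg')) => x Ux /=.
by rewrite deriveD; [|apply: df|apply: dg].
Qed.

Lemma CkM k U f g : open U -> Ck k U f -> Ck k U g -> Ck k U (f * g).
Proof.
move=> oU; elim: k f g => [|k IH] f g cf cg.
  by move=> x Ux; apply: continuousM; [apply: cf|apply: cg].
split.
  by move=> x Ux; apply: continuousM;
    [apply: (Ck_continuous cf)|apply: (Ck_continuous cg)].
have cfk := Ck_S cf; have cgk := Ck_S cg.
case: cf cg => _ hf [_ hg] i; have [df hf'] := hf i; have [dg hg'] := hg i.
split; first by move=> x Ux; apply: derivableM; [apply: df|apply: dg].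
apply: (Ck_eq oU _ (CkD oU (IH _ _ cfk hg') (IH _ _ cgk hf'))) => x Ux /=.
by rewrite deriveM; [|apply: df|apply: dg].
Qed.

Lemma Ck_cst k U (c : R) : open U -> Ck k U (cst c).
Proof.
move=> oU; elim: k c => [|k IH] c; first by move=> x _; exact: cst_continuous.
split; first by move=> x _; exact: cst_continuous.
move=> i; split; first by move=> x _; exact: derivable_cst.
by apply: (Ck_eq oU _ (IH 0)) => x _; rewrite derive_cst.
Qed.

End SmoothEuclidean.

(* `chart_inv` is only relevant on the image `chart_map @` chart_dom`. *)
Record chart (R : realType) (m : nat) (T : topologicalType) := Chart {
  chart_dom : set T;
  chart_map : T -> 'rV[R]_m;
  chart_inv : 'rV[R]_m -> T;
  chart_dom_open : open chart_dom;
  chart_img_open : open (chart_map @` chart_dom);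
  chart_mapK : forall p, chart_dom p -> chart_inv (chart_map p) = p;
  chart_map_continuous : {within chart_dom, continuous chart_map};
  chart_inv_continuous :
    {within chart_map @` chart_dom, continuous chart_inv} }.

Definition smooth_transition (R : realType) (m : nat) (T : topologicalType)
    (c d : chart R m T) : Prop :=
  forall i : 'I_m, Cinfty (chart_map c @` (chart_dom c `&` chart_dom d))
    (fun x => chart_map d (chart_inv c x) 0 i).

(* The smooth structure is the one generated by the given atlas, which need
   not be maximal. *)
Record manifold (R : realType) (m : nat) := Manifold {
  carrier :> topologicalType;
  manifold_hausdorff : hausdorff_space carrier;
  manifold_second_countable : @second_countable carrier;
  atlas : set (chart R m carrier);
  atlas_cover : forall p : carrier, exists2 c, atlas c & chart_dom c p;
  atlas_compat : forall c d, atlas c -> atlas d -> smooth_transition c d }.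

Section SmoothFunctions.
Context {R : realType} {m : nat}.
Variable M : manifold R m.

Definition smooth (f : M -> R) : Prop :=
  forall c, atlas c -> Cinfty (chart_map c @` chart_dom c) (f \o chart_inv c).

Definition smooth_pred : {pred M -> R} := fun f => `[< smooth f >].

Lemma smoothP (f : M -> R) : reflect (smooth f) (f \in smooth_pred).
Proof. exact: asboolP. Qed.

Lemma smooth_cst (a : R) : smooth (cst a : M -> R).
Proof. by move=> c _ k; exact/Ck_cst/chart_img_open. Qed.

Lemma smoothD (f g : M -> R) : smooth f -> smooth g -> smooth (f + g).
Proof.
by move=> sf sg c ac k; apply: (CkD _ (sf c ac k) (sg c ac k));
  exact: chart_img_open.
Qed.

Lemma smoothM (f g : M -> R) : smooth f -> smooth g -> smooth (f * g).
Proof.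
by move=> sf sg c ac k; apply: (CkM _ (sf c ac k) (sg c ac k));
  exact: chart_img_open.
Qed.

Lemma smoothZ (a : R) (f : M -> R) : smooth f -> smooth (a *: f).
Proof. exact/smoothM/smooth_cst. Qed.

Lemma smoothN (f : M -> R) : smooth f -> smooth (- f).
Proof. by rewrite -scaleN1r; exact: smoothZ. Qed.

Lemma smoothB (f g : M -> R) : smooth f -> smooth g -> smooth (f - g).
Proof. by move=> sf /smoothN; exact: smoothD. Qed.

Fact smooth_subring_closed : subring_closed smooth_pred.
Proof.
split=> [|f g /smoothP sf /smoothP sg|f g /smoothP sf /smoothP sg]; apply/smoothP.
- exact: smooth_cst.
- exact: smoothB.
- exact: smoothM.
Qed.
HB.instance Definition _ :=
  GRing.isSubringClosed.Build (M -> R) smooth_pred smooth_subring_closed.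

Fact smooth_scaler_closed : scaler_closed smooth_pred.
Proof. by move=> a f /smoothP sf; apply/smoothP; exact: smoothZ. Qed.
HB.instance Definition _ :=
  GRing.isScaleClosed.Build R (M -> R) smooth_pred smooth_scaler_closed.

Record smooth_fun := SmoothFun {
  smooth_val :> M -> R;
  _ : smooth_val \in smooth_pred }.

HB.instance Definition _ := [isSub for smooth_val].
HB.instance Definition _ := [Choice of smooth_fun by <:].
HB.instance Definition _ := GRing.SubChoice_isSubComPzRing.Build
  (M -> R) smooth_pred smooth_fun smooth_subring_closed.
HB.instance Definition _ := [SubZmodule_isSubLmodule of smooth_fun by <:].

End SmoothFunctions.

Section TangentSpace.
Context {R : realType} {m : nat} {M : manifold R m}.
Implicit Types (p : M) (f g : smooth_fun M).

Lemma smooth_funP f : smooth f.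
Proof. by case: f => f /= /smoothP. Qed.

Definition mk_smooth (f : M -> R) (sf : smooth f) : smooth_fun M :=
  SmoothFun (introT (smoothP f) sf).

(* The tangent space at p consists of the derivations at p of C^oo(M). *)
Definition derivation_at p (v : smooth_fun M -> R) : Prop :=
  scalar v /\ forall f g, v (f * g) = f p * v g + g p * v f.

Definition tangent_pred p : {pred smooth_fun M -> R} :=
  fun v => `[< derivation_at p v >].

Lemma tangentP p v : reflect (derivation_at p v) (v \in tangent_pred p).
Proof. exact: asboolP. Qed.

Fact tangent_submod_closed p : submod_closed (tangent_pred p).
Proof.
split=> [|a u v /tangentP[ul uM] /tangentP[vl vM]]; apply/tangentP; split.
- by move=> a f g; rewrite /= mulr0 addr0.
- by move=> f g; rewrite !mulr0 addr0.
- move=> b f g /=; rewrite -![(a *: u + v) _]/(a * u _ + v _) ul vl.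
  by rewrite !mulrDr addrACA !mulrA (mulrC a b).
- move=> f g; rewrite -![(a *: u + v) _]/(a * u _ + v _) uM vM.
  by rewrite !mulrDr addrACA !mulrA !(mulrC a).
Qed.
HB.instance Definition _ p := GRing.isSubmodClosed.Build R
  (smooth_fun M -> R) (tangent_pred p) (tangent_submod_closed p).

Record tangent p := Tangent {
  tangent_val :> smooth_fun M -> R;
  _ : tangent_val \in tangent_pred p }.

HB.instance Definition _ p := [isSub for @tangent_val p].
HB.instance Definition _ p := [Choice of tangent p by <:].
HB.instance Definition _ p := [SubChoice_isSubLmodule of tangent p by <:].

Lemma tangent_derivation p (v : tangent p) : derivation_at p v.
Proof. by case: v => v /= /tangentP. Qed.

Definition mk_tangent p (v : smooth_fun M -> R) (hv : derivation_at p v) :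
  tangent p := Tangent (introT (tangentP p v) hv).

Definition is_basis p (e : 'I_m -> tangent p) : Prop :=
  forall v : tangent p, exists! a : 'rV[R]_m, v = \sum_i a 0 i *: e i.

End TangentSpace.

Section VectorFields.
Context {R : realType} {m : nat}.
Variable M : manifold R m.

Record vector_field := VectorField {
  vf_at :> forall p : M, tangent p;
  vf_smooth : forall f : smooth_fun M, smooth (fun p => vf_at p f) }.

Lemma vector_field_eq (X Y : vector_field) : (forall p, X p = Y p) -> X = Y.
Proof.
case: X Y => [X sX] [Y sY] /= XY.
have {}XY : X = Y by apply: functional_extensionality_dep.
by case: _ / XY sY => sY; congr VectorField; exact: Prop_irrelevance.
Qed.

HB.instance Definition _ := gen_eqMixin vector_field.
HB.instance Definition _ := gen_choiceMixin vector_field.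

Fact vf_zero_smooth (f : smooth_fun M) : smooth (fun p => (0 : tangent p) f).
Proof. exact: smooth_cst. Qed.
Definition vf_zero := VectorField vf_zero_smooth.

Fact vf_add_smooth (X Y : vector_field) (f : smooth_fun M) :
  smooth (fun p => (X p + Y p) f).
Proof. exact: smoothD (vf_smooth X f) (vf_smooth Y f). Qed.
Definition vf_add (X Y : vector_field) := VectorField (vf_add_smooth X Y).

Fact vf_opp_smooth (X : vector_field) (f : smooth_fun M) :
  smooth (fun p => (- X p) f).
Proof. exact: smoothN (vf_smooth X f). Qed.
Definition vf_opp (X : vector_field) := VectorField (vf_opp_smooth X).

Fact vf_scale_smooth (h : smooth_fun M) (X : vector_field) (f : smooth_fun M) :
  smooth (fun p => (h p *: X p) f).
Proof. exact: smoothM (smooth_funP h) (vf_smooth X f). Qed.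
Definition vf_scale (h : smooth_fun M) (X : vector_field) :=
  VectorField (vf_scale_smooth h X).

Fact vf_addA : associative vf_add.
Proof. by move=> X Y Z; apply: vector_field_eq => p /=; rewrite addrA. Qed.
Fact vf_addC : commutative vf_add.
Proof. by move=> X Y; apply: vector_field_eq => p /=; rewrite addrC. Qed.
Fact vf_add0 : left_id vf_zero vf_add.
Proof. by move=> X; apply: vector_field_eq => p /=; rewrite add0r. Qed.
Fact vf_addN : left_inverse vf_zero vf_opp vf_add.
Proof. by move=> X; apply: vector_field_eq => p /=; rewrite addNr. Qed.
HB.instance Definition _ :=
  GRing.isZmodule.Build vector_field vf_addA vf_addC vf_add0 vf_addN.

Fact vf_scaleA (a b : smooth_fun M) X :
  vf_scale a (vf_scale b X) = vf_scale (a * b) X.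
Proof. by apply: vector_field_eq => p /=; rewrite scalerA. Qed.
Fact vf_scale1 : left_id 1 vf_scale.
Proof. by move=> X; apply: vector_field_eq => p /=; rewrite scale1r. Qed.
Fact vf_scaleDr : right_distributive vf_scale +%R.
Proof. by move=> a X Y; apply: vector_field_eq => p /=; rewrite scalerDr. Qed.
Fact vf_scaleDl X : {morph vf_scale^~ X : a b / a + b}.
Proof. by move=> a b; apply: vector_field_eq => p /=; rewrite scalerDl. Qed.
HB.instance Definition _ := GRing.Zmodule_isLmodule.Build (smooth_fun M)
  vector_field vf_scaleA vf_scale1 vf_scaleDr vf_scaleDl.

End VectorFields.

Section Calculus.
Context {R : realType} {m : nat} {M : manifold R m}.
Local Notation VF := (vector_field M).
Local Notation CM := (smooth_fun M).

Definition vf_app (X : VF) (f : CM) : CM := mk_smooth (vf_smooth X f).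

Fact bracket_derivation (X Y : VF) (p : M) :
  derivation_at p (fun f => X p (vf_app Y f) - Y p (vf_app X f)).
Proof.
have [Xl XM] := tangent_derivation (X p).
have [Yl YM] := tangent_derivation (Y p).
have appl (Z : VF) a f g : vf_app Z (a *: f + g) = a *: vf_app Z f + vf_app Z g.
  by apply: val_inj; apply/funext => q; have [Zl _] := tangent_derivation (Z q);
    exact: Zl.
have appM (Z : VF) f g : vf_app Z (f * g) = f * vf_app Z g + g * vf_app Z f.
  by apply: val_inj; apply/funext => q; have [_ ZM] := tangent_derivation (Z q);
    exact: ZM.
have XD f g : X p (f + g) = X p f + X p g.
  by have := Xl 1 f g; rewrite scale1r mul1r.
have YD f g : Y p (f + g) = Y p f + Y p g.
  by have := Yl 1 f g; rewrite scale1r mul1r.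
split=> [a f g|f g].
  by rewrite !appl Xl Yl mulrBr opprD addrACA.
rewrite !appM XD YD !XM !YM /=; ring.
Qed.

Definition bracket_at (X Y : VF) (p : M) : tangent p :=
  mk_tangent (bracket_derivation X Y p).

Fact bracket_smooth (X Y : VF) (f : CM) : smooth (fun p => bracket_at X Y p f).
Proof. exact: smoothB (vf_smooth X (vf_app Y f)) (vf_smooth Y (vf_app X f)). Qed.

Definition bracket (X Y : VF) : VF := VectorField (bracket_smooth X Y).

Record endo_field := EndoField {
  endo_at :> forall p : M, {linear tangent p -> tangent p};
  endo_smooth : forall (X : VF) (f : CM), smooth (fun p => endo_at p (X p) f) }.

Definition endo_app (phi : endo_field) (X : VF) : VF :=
  VectorField (endo_smooth phi X).

Record one_form := OneForm {
  form_at :> forall p : M, {scalar tangent p};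
  form_smooth : forall X : VF, smooth (fun p => form_at p (X p)) }.

Definition form_app (eta : one_form) (X : VF) : CM :=
  mk_smooth (form_smooth eta X).

Record pseudo_metric := PseudoMetric {
  metric_at :> forall p : M, tangent p -> tangent p -> R;
  metric_linear : forall p (u : tangent p), scalar (metric_at u);
  metric_sym : forall p (u v : tangent p), metric_at u v = metric_at v u;
  metric_nondegenerate : forall p (u : tangent p),
    (forall v, metric_at u v = 0) -> u = 0;
  metric_smooth : forall X Y : VF, smooth (fun p => metric_at (X p) (Y p)) }.

Definition metric_app (g : pseudo_metric) (X Y : VF) : CM :=
  mk_smooth (metric_smooth g X Y).

(* Affine connections: the vector fields form a module over smooth_fun M. *)
Record connection := Connection {
  nabla :> VF -> VF -> VF;
  nablaDl : forall X X' Y, nabla (X + X') Y = nabla X Y + nabla X' Y;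
  nablaZl : forall (f : CM) X Y, nabla (f *: X) Y = f *: nabla X Y;
  nablaDr : forall X Y Y', nabla X (Y + Y') = nabla X Y + nabla X Y';
  nabla_leibniz : forall (f : CM) X Y,
    nabla X (f *: Y) = vf_app X f *: Y + f *: nabla X Y }.

Definition levi_civita (g : pseudo_metric) (D : connection) : Prop :=
  (forall X Y, D X Y - D Y X = bracket X Y) /\
  (forall X Y Z, vf_app X (metric_app g Y Z) =
     metric_app g (D X Y) Z + metric_app g Y (D X Z)).

Definition cov_endo (D : connection) (phi : endo_field) (X Y : VF) : VF :=
  D X (endo_app phi Y) - endo_app phi (D X Y).

Definition cov_form (D : connection) (eta : one_form) (X Y : VF) : CM :=
  vf_app X (form_app eta Y) - form_app eta (D X Y).

Definition almost_contact (phi : endo_field) (xi : VF) (eta : one_form) :=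
  (forall p (u : tangent p), phi p (phi p u) = - u + eta p u *: xi p) /\
  (forall p, eta p (xi p) = 1).

Definition norden (phi : endo_field) (eta : one_form) (g : pseudo_metric) :=
  forall p (u v : tangent p),
    g p (phi p u) (phi p v) = - g p u v + eta p u * eta p v.

Definition tensorF (phi : endo_field) (g : pseudo_metric) (D : connection)
  (X Y Z : VF) : CM := metric_app g (cov_endo D phi X Y) Z.

Definition omega (phi : endo_field) (xi : VF) (g : pseudo_metric)
  (D : connection) (Z : VF) : CM := tensorF phi g D xi xi Z.

Definition classF11 (phi : endo_field) (xi : VF) (eta : one_form)
    (g : pseudo_metric) (D : connection) : Prop :=
  forall X Y Z, tensorF phi g D X Y Z =
    form_app eta X * (form_app eta Y * omega phi xi g D Z +
                      form_app eta Z * omega phi xi g D Y).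

Definition nijenhuis (phi : endo_field) (xi : VF) (eta : one_form)
    (D : connection) (X Y : VF) : VF :=
  let ph := endo_app phi in
  ph (ph (bracket X Y)) + bracket (ph X) (ph Y)
  - ph (bracket (ph X) Y) - ph (bracket X (ph Y))
  + cov_form D eta X Y *: xi - cov_form D eta Y X *: xi.

Definition gram (g : pseudo_metric) (p : M) (e : 'I_m -> tangent p) : 'M[R]_m :=
  \matrix_(i, j) g p (e i) (e j).

(* Square norms at p of tensors of type (1,2) and (0,2) that are given as
   operators on vector fields. The E i are vector fields whose values at p form
   a basis e of the tangent space at p, so that T (E i) (E k) p is the value of
   the tensor T at the vectors e i and e k. *)
Definition sqnorm_vec (g : pseudo_metric) (p : M) (E : 'I_m -> VF)
    (T : VF -> VF -> VF) : R :=
  let gi := invmx (gram g (fun i => E i p)) in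
  \sum_i \sum_j \sum_k \sum_s
    gi i j * gi k s * g p (T (E i) (E k) p) (T (E j) (E s) p).

Definition sqnorm_form (g : pseudo_metric) (p : M) (E : 'I_m -> VF)
    (T : VF -> VF -> CM) : R :=
  let gi := invmx (gram g (fun i => E i p)) in
  \sum_i \sum_j \sum_k \sum_s
    gi i j * gi k s * (T (E i) (E k) p * T (E j) (E s) p).

End Calculus.

Arguments endo_field {R m} M.
Arguments one_form {R m} M.
Arguments pseudo_metric {R m} M.
Arguments connection {R m} M.

(* Main.v *)
Require Import Defs.
From mathcomp Require Import all_boot all_order all_algebra.
From mathcomp Require Import all_classical all_reals all_analysis.
From mathcomp Require Import ring.

Set Implicit Arguments.
Unset Strict Implicit.
Unset Printing Implicit Defensive.

Import GRing.Theory.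
Local Open Scope ring_scope.

(** On an F11-manifold all three tensors are explicit expressions in [xi],
    [eta] and [Omega].  Nondegeneracy of [g] turns the defining identity into
    [(D_X phi) Y = eta X *: (eta Y *: Omega + omega Y *: xi)]
    ([cov_endo_F11]).  Differentiating [phi xi = 0] then gives
    [D_X xi = eta X *: phi Omega] ([cov_xi]), hence
    [(D_X eta) Y = eta X * alpha Y] with [alpha = g (phi Omega)]
    ([cov_form_F11]).  As [D] has no torsion, the Nijenhuis tensor can be
    written with [D phi] and [D eta]; its [D phi]-part vanishes, which leaves
    [N X Y = (eta X * alpha Y - eta Y * alpha X) *: xi] ([nijenhuis_F11]).

    Each square norm is therefore a sum of products of contractions of pairs
    of 1-forms, and the contraction of [g u] with [g v] is [g u v]
    ([contract_gram]).  Only the following values occur: [g xi xi = 1],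
    [g xi Omega = 0], [g xi (phi Omega) = 0], and, by the Norden condition,
    [g (phi Omega) (phi Omega) = - g Omega Omega].  They give
    [|D phi|^2 = 2 * g Omega Omega], [|D eta|^2 = - g Omega Omega] and
    [|N|^2 = - (2 * g Omega Omega)], where [g Omega Omega = omega Omega]. *)

(** * Contractions with an inverse Gram matrix *)

Section Contraction.
Context {F : fieldType} {m : nat}.
Implicit Types (w : 'M[F]_m) (S : 'I_m -> 'I_m -> 'I_m -> 'I_m -> F).

Definition contract w (P : 'I_m -> 'I_m -> F) : F :=
  \sum_i \sum_j w i j * P i j.

Definition contract4 w S : F :=
  \sum_i \sum_j \sum_k \sum_s w i j * w k s * S i j k s.

Lemma eq_contract4 w S S' :
  (forall i j k s, S i j k s = S' i j k s) -> contract4 w S = contract4 w S'.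
Proof.
move=> eqS; apply: eq_bigr => i _; apply: eq_bigr => j _.
by apply: eq_bigr => k _; apply: eq_bigr => s _; rewrite eqS.
Qed.

Lemma contract4D w S S' :
  contract4 w (fun i j k s => S i j k s + S' i j k s) =
  contract4 w S + contract4 w S'.
Proof.
rewrite -big_split; apply: eq_bigr => i _; rewrite -big_split.
apply: eq_bigr => j _; rewrite -big_split; apply: eq_bigr => k _.
by rewrite -big_split; apply: eq_bigr => s _; rewrite mulrDr.
Qed.

Lemma contract4M w P Q :
  contract4 w (fun i j k s => P i j * Q k s) = contract w P * contract w Q.
Proof.
rewrite /contract mulr_suml; apply: eq_bigr => i _.
rewrite mulr_suml; apply: eq_bigr => j _.
rewrite mulr_sumr; apply: eq_bigr => k _.
by rewrite mulr_sumr; apply: eq_bigr => s _; rewrite mulrACA.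
Qed.

Lemma contractZ w (a : F) P :
  contract w (fun i j => a * P i j) = a * contract w P.
Proof.
rewrite /contract mulr_sumr; apply: eq_bigr => i _; rewrite mulr_sumr.
by apply: eq_bigr => j _; rewrite mulrCA.
Qed.

End Contraction.

Section Gram.
Context {F : fieldType} {m : nat} {V : lmodType F}.
Variables (B : V -> V -> F) (e : 'I_m -> V).
Hypothesis Blin : forall u, scalar (B u).
Hypothesis Bsym : forall u v, B u v = B v u.
Hypothesis Bnondeg : forall u, (forall v, B u v = 0) -> u = 0.
Hypothesis e_basis : forall v, exists! a : 'rV[F]_m, v = \sum_i a 0 i *: e i.

Let G : 'M[F]_m := \matrix_(i, j) B (e i) (e j).

Lemma form_sumr u (a : 'rV[F]_m) :
  B u (\sum_i a 0 i *: e i) = \sum_i a 0 i * B u (e i).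
Proof.
have BD x y : B u (x + y) = B u x + B u y.
  by have := Blin u 1 x y; rewrite scale1r mul1r.
have B0 : B u 0 = 0 by apply: (addrI (B u 0)); rewrite -BD !addr0.
rewrite (big_morph (B u) BD B0); apply: eq_bigr => i _.
by have := Blin u (a 0 i) (e i) 0; rewrite !addr0 B0 addr0.
Qed.

Lemma gram_row (a : 'rV[F]_m) j : (a *m G) 0 j = B (\sum_i a 0 i *: e i) (e j).
Proof.
rewrite Bsym form_sumr mxE; apply: eq_bigr => i _.
by rewrite mxE Bsym.
Qed.

Lemma gram_unit : G \in unitmx.
Proof.
rewrite -row_free_unit; apply/inj_row_free => a aG0.
have a0 : \sum_i a 0 i *: e i = 0.
  apply: Bnondeg => v; have [b [-> _]] := e_basis v.
  rewrite form_sumr big1 // => j _.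
  by rewrite -gram_row aG0 mxE mulr0.
have [b [_ b_uniq]] := e_basis 0.
rewrite -(b_uniq a); last by rewrite a0.
by apply: b_uniq; rewrite big1 // => i _; rewrite mxE scale0r.
Qed.

(** The inverse Gram matrix is the Gram matrix of the dual form: with row
    coordinates [a], [b] of [u], [v], the components are [a *m G] and [b *m G],
    and [(a *m G) *m invmx G *m (b *m G)^T] collapses to [a *m (b *m G)^T]. *)
Lemma contract_gram u v :
  contract (invmx G) (fun i j => B u (e i) * B v (e j)) = B u v.
Proof.
have [a [ua _]] := e_basis u; have [b [vb _]] := e_basis v.
have Bu i : B u (e i) = (a *m G) 0 i by rewrite gram_row -ua.
have Bv i : B v (e i) = (b *m G) 0 i by rewrite gram_row -vb.
transitivity ((a *m G *m invmx G *m (b *m G)^T) 0 0).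
  rewrite mxE /contract exchange_big /=; apply: eq_bigr => j _.
  rewrite mxE mulr_suml; apply: eq_bigr => i _.
  by rewrite Bu Bv [(_^T) _ _]mxE; ring.
rewrite (mulmxK gram_unit) Bsym ua form_sumr mxE; apply: eq_bigr => i _.
by rewrite Bv [(_^T) _ _]mxE.
Qed.

End Gram.

(** * Pointwise algebra of almost contact structures with a Norden metric *)

Section Pointwise.
Context {R : realType} {m : nat} {M : manifold R m}.
Variables (phi : endo_field M) (xi : vector_field M) (eta : one_form M).
Variable g : pseudo_metric M.
Hypothesis hcontact : almost_contact phi xi eta.
Hypothesis hnorden : norden phi eta g.
Implicit Types (p : M).

Lemma metricDr p (u v w : tangent p) : g p u (v + w) = g p u v + g p u w.
Proof. by have := metric_linear g u 1 v w; rewrite scale1r mul1r. Qed.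

Lemma metric0r p (u : tangent p) : g p u 0 = 0.
Proof. by apply: (addrI (g p u 0)); rewrite -metricDr !addr0. Qed.

Lemma metricZr p (a : R) (u v : tangent p) : g p u (a *: v) = a * g p u v.
Proof. by have := metric_linear g u a v 0; rewrite !addr0 metric0r addr0. Qed.

Lemma metricDl p (u v w : tangent p) : g p (u + v) w = g p u w + g p v w.
Proof. by rewrite !(Defs.metric_sym g _ w) metricDr. Qed.

Lemma metricZl p (a : R) (u v : tangent p) : g p (a *: u) v = a * g p u v.
Proof. by rewrite !(Defs.metric_sym g _ v) metricZr. Qed.

Lemma metric_inj p (u v : tangent p) : (forall w, g p u w = g p v w) -> u = v.
Proof.
move=> uv; apply/eqP; rewrite -subr_eq0; apply/eqP.
apply: (metric_nondegenerate (p0 := g)) => w.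
by rewrite -scaleN1r metricDl metricZl uv mulN1r subrr.
Qed.

Lemma phi_phi p (u : tangent p) : phi p (phi p u) = - u + eta p u *: xi p.
Proof. exact: (proj1 hcontact). Qed.

Lemma eta_xi p : eta p (xi p) = 1.
Proof. exact: (proj2 hcontact). Qed.

Lemma phiD p (u v : tangent p) : phi p (u + v) = phi p u + phi p v.
Proof. exact: linearD. Qed.

Lemma phiN p (u : tangent p) : phi p (- u) = - phi p u.
Proof. exact: linearN. Qed.

Lemma phiZ p (a : R) (u : tangent p) : phi p (a *: u) = a *: phi p u.
Proof. exact: linearZ. Qed.

Lemma xi_neq0 p : xi p != 0.
Proof.
apply/eqP => xi0; have := eta_xi p; rewrite xi0 linear0 => /eqP.
by rewrite eq_sym oner_eq0.
Qed.

(** Since [phi (phi xi) = 0], the structure equation at [phi xi] makes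
    [phi xi] a multiple [c *: xi]; then [phi (phi xi) = c ^ 2 *: xi], so
    [c = 0]. *)
Lemma phi_xi p : phi p (xi p) = 0.
Proof.
have phi2 : phi p (phi p (xi p)) = 0 by rewrite phi_phi eta_xi scale1r addNr.
have [c phic] : exists c, phi p (xi p) = c *: xi p.
  exists (eta p (phi p (xi p))).
  by apply/eqP; rewrite eq_sym -subr_eq0 addrC -phi_phi phi2 linear0.
move: phi2; rewrite phic phiZ phic scalerA => /eqP.
rewrite scaler_eq0 (negbTE (xi_neq0 p)) orbF mulf_eq0 orbb => /eqP c0.
by rewrite c0 scale0r.
Qed.

(** Both ways of associating [phi ^ 3] agree, and they differ by
    [eta (phi u) *: xi]. *)
Lemma eta_phi p (u : tangent p) : eta p (phi p u) = 0.
Proof.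
have := phi_phi (phi p u); rewrite (phi_phi u) phiD phiN phiZ phi_xi.
rewrite scaler0 => /addrI/esym/eqP.
by rewrite scaler_eq0 (negbTE (xi_neq0 p)) orbF => /eqP.
Qed.

Lemma eta_metric p (u : tangent p) : eta p u = g p u (xi p).
Proof.
have := hnorden u (xi p); rewrite phi_xi metric0r eta_xi mulr1.
by move/esym/eqP; rewrite addrC subr_eq0 => /eqP.
Qed.

Lemma metric_xi p : g p (xi p) (xi p) = 1.
Proof. by rewrite -eta_metric eta_xi. Qed.

End Pointwise.

(** * Covariant derivatives of an F11-structure *)

Section F11.
Context {R : realType} {m : nat} {M : manifold R m}.
Variables (phi : endo_field M) (xi : vector_field M) (eta : one_form M).
Variables (g : pseudo_metric M) (D : connection M) (Omega : vector_field M).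
Hypothesis hcontact : almost_contact phi xi eta.
Hypothesis hnorden : norden phi eta g.
Hypothesis hLC : levi_civita g D.
Hypothesis hF11 : classF11 phi xi eta g D.
Hypothesis hOmega : forall X : vector_field M,
  omega phi xi g D X = metric_app g X Omega.
Variables (p : M) (E : 'I_m -> vector_field M).
Hypothesis E_basis : is_basis (fun i => E i p).
Implicit Types (X Y Z : vector_field M) (u v : tangent p).

(** The defining identity of the class is about vector fields, whereas
    nondegeneracy of [g] is tested on vectors at [p]; constant-coefficient
    combinations of the [E i] link the two. *)
Lemma extend_vector u : exists X : vector_field M, X p = u.
Proof.
have [a [-> _]] := E_basis u.
exists (\sum_i mk_smooth (smooth_cst (M := M) (a 0 i)) *: E i).
by apply: (big_ind2 (fun (X : vector_field M) v => X p = v)) => //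
  X v Y w <- <-.
Qed.

Lemma omegaE X : omega phi xi g D X p = g p (X p) (Omega p).
Proof. by rewrite hOmega. Qed.

Lemma cov_endo_F11 X Y : cov_endo D phi X Y p =
  eta p (X p) *: (eta p (Y p) *: Omega p + g p (Y p) (Omega p) *: xi p).
Proof.
apply: (metric_inj (g := g)) => w; have [Z <-] := extend_vector w.
have := congr1 (fun f : smooth_fun M => f p) (hF11 X Y Z).
rewrite -[LHS]/(g p (cov_endo D phi X Y p) (Z p)) => ->.
rewrite -[LHS]/(eta p (X p) * (eta p (Y p) * omega phi xi g D Z p +
                            eta p (Z p) * omega phi xi g D Y p)) !omegaE.
rewrite metricZl metricDl !metricZl (Defs.metric_sym g (xi p)).
rewrite -(eta_metric hcontact hnorden) (Defs.metric_sym g (Z p)); ring.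
Qed.

(** The defining identity of the class at [xi, xi, xi] reads
    [omega xi = 2 * omega xi]. *)
Lemma metric_xi_Omega : g p (xi p) (Omega p) = 0.
Proof.
have := congr1 (fun f : smooth_fun M => f p) (hF11 xi xi xi).
rewrite -[LHS]/(omega phi xi g D xi p).
rewrite -[RHS]/(eta p (xi p) * (eta p (xi p) * omega phi xi g D xi p +
                            eta p (xi p) * omega phi xi g D xi p)) !omegaE.
by rewrite (eta_xi hcontact) !mul1r => /eqP; rewrite -subr_eq0 opprD addNKr oppr_eq0
  => /eqP.
Qed.

Lemma connection0r X : D X 0 = 0.
Proof. by apply: (addrI (D X 0)); rewrite -nablaDr !addr0. Qed.

Lemma vf_app1 X q : vf_app X 1 q = 0.
Proof.
have [_ XM] := tangent_derivation (X q).
have := XM 1 1; rewrite mulr1 !mul1r => /eqP.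
by rewrite -subr_eq0 opprD addNKr oppr_eq0 => /eqP.
Qed.

(** [xi] is a unit field, so [g (D X xi) xi] is half the derivative of the
    constant [g xi xi = 1]. *)
Lemma eta_cov_xi X : eta p (D X xi p) = 0.
Proof.
have [_ Dg] := hLC.
have gxi1 : metric_app g xi xi = 1.
  apply: val_inj; apply/funext => q.
  exact: (metric_xi hcontact hnorden).
have := congr1 (fun f : smooth_fun M => f p) (Dg X xi xi).
rewrite gxi1 [LHS]vf_app1.
rewrite -[X in _ = X]/(g p (D X xi p) (xi p) + g p (xi p) (D X xi p)).
rewrite (Defs.metric_sym g (xi p)) -(eta_metric hcontact hnorden) => /esym/eqP.
by rewrite -mulr2n -mulr_natr mulf_eq0 Num.Theory.pnatr_eq0 orbF => /eqP.
Qed.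

(** Differentiating [phi xi = 0] gives [phi (D X xi) = - (D X phi) xi], and
    [D X xi], being orthogonal to [xi], is recovered by applying [- phi]. *)
Lemma cov_xi X : D X xi p = eta p (X p) *: phi p (Omega p).
Proof.
have phixi0 : endo_app phi xi = 0.
  by apply: vector_field_eq => q; exact: (phi_xi hcontact).
have := cov_endo_F11 X xi.
rewrite /cov_endo phixi0 connection0r sub0r metric_xi_Omega (eta_xi hcontact).
rewrite scale0r addr0 scale1r -[LHS]/(- phi p (D X xi p)) => phiDxi.
have := phi_phi hcontact (D X xi p); rewrite eta_cov_xi scale0r addr0.
by move/(congr1 -%R); rewrite opprK -phiN phiDxi phiZ.
Qed.

Lemma cov_form_F11 X Y :
  cov_form D eta X Y p = eta p (X p) * g p (Y p) (phi p (Omega p)).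
Proof.
have [_ Dg] := hLC.
have etaE : form_app eta Y = metric_app g Y xi.
  by apply: val_inj; apply/funext => q;
    exact: (eta_metric hcontact hnorden).
rewrite -[LHS]/(vf_app X (form_app eta Y) p - eta p (D X Y p)) etaE Dg.
rewrite -[LHS]/(g p (D X Y p) (xi p) + g p (Y p) (D X xi p) - eta p (D X Y p)).
by rewrite (eta_metric hcontact hnorden) addrAC subrr add0r cov_xi metricZr.
Qed.

(** Writing the brackets with the torsion-free connection turns [N X Y] into
    [(D_(phi X) phi) Y - (D_(phi Y) phi) X - phi ((D_X phi) Y)
     + phi ((D_Y phi) X)] plus the [xi]-component.  The first two terms vanish
    because [eta] kills the image of [phi], the next two cancel because
    [phi ((D_X phi) Y) = eta X * eta Y *: phi Omega] is symmetric. *)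
Lemma nijenhuis_F11 X Y : nijenhuis phi xi eta D X Y p =
  (cov_form D eta X Y p - cov_form D eta Y X p) *: xi p.
Proof.
have [torsion_free _] := hLC.
have phi_cov X1 Y1 : phi p (cov_endo D phi X1 Y1 p) =
    (eta p (X1 p) * eta p (Y1 p)) *: phi p (Omega p).
  rewrite cov_endo_F11 phiZ phiD !phiZ (phi_xi hcontact).
  by rewrite scaler0 addr0 scalerA.
have cov_phi X1 Y1 : cov_endo D phi (endo_app phi X1) Y1 p = 0.
  by rewrite cov_endo_F11 /= (eta_phi hcontact) scale0r.
have bracketE X1 Y1 : bracket X1 Y1 p = D X1 Y1 p - D Y1 X1 p.
  by rewrite -torsion_free.
have D_phi X1 Y1 : D X1 (endo_app phi Y1) p =
    cov_endo D phi X1 Y1 p + phi p (D X1 Y1 p).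
  by rewrite -[cov_endo _ _ _ _ _]/(D X1 (endo_app phi Y1) p -
    phi p (D X1 Y1 p)) subrK.
have D_phi_phi X1 Y1 : D (endo_app phi X1) (endo_app phi Y1) p =
    phi p (D (endo_app phi X1) Y1 p).
  by rewrite D_phi cov_phi add0r.
have phi_D_phi X1 Y1 : phi p (D X1 (endo_app phi Y1) p) =
    (eta p (X1 p) * eta p (Y1 p)) *: phi p (Omega p) +
    phi p (phi p (D X1 Y1 p)).
  by rewrite D_phi phiD phi_cov.
rewrite -[LHS]/(phi p (phi p (bracket X Y p))
  + bracket (endo_app phi X) (endo_app phi Y) p
  - phi p (bracket (endo_app phi X) Y p) - phi p (bracket X (endo_app phi Y) p)
  + cov_form D eta X Y p *: xi p - cov_form D eta Y X p *: xi p).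
rewrite -addrA -scalerBl !bracketE !D_phi_phi.
rewrite !(phiD, phiN) !phi_D_phi (mulrC (eta p (Y p))) -[RHS]add0r.
congr (_ + _); set S := _ *: phi p (Omega p).
set A := phi p (phi p (D X Y p)); set B := phi p (phi p (D Y X p)).
set C := phi p (D _ Y p); set C' := phi p (D _ X p).
apply/eqP; rewrite -addrA -opprD subr_eq0; apply/eqP.
rewrite opprD [C + _]addrC -!addrA (addrCA C S) (addrCA (- B) S) addKr.
by rewrite (addrCA C A) (addrCA (- B) A).
Qed.

End F11.

(** * The square norms *)

Theorem proposition2p1 (R : realType) (n : nat) (M : manifold R (2 * n + 1)%N)
    (phi : endo_field M) (xi : vector_field M) (eta : one_form M)
    (g : pseudo_metric M) (D : connection M) (Omega : vector_field M)
    (hcontact : almost_contact phi xi eta) (hnorden : norden phi eta g)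
    (hLC : levi_civita g D) (hF11 : classF11 phi xi eta g D)
    (hOmega : forall X : vector_field M,
       omega phi xi g D X = metric_app g X Omega)
    (p : M) (e : 'I_(2 * n + 1) -> tangent p) (he : is_basis e)
    (E : 'I_(2 * n + 1) -> vector_field M) (hE : forall i, E i p = e i) :
  let norm_Dphi := sqnorm_vec g p E (cov_endo D phi) in
  let norm_N := sqnorm_vec g p E (nijenhuis phi xi eta D) in
  let norm_Deta := sqnorm_form g p E (cov_form D eta) in
  [/\ norm_Dphi = - norm_N,
      - norm_N = - (2 * norm_Deta) &
      - (2 * norm_Deta) = 2 * omega phi xi g D Omega p].
Proof.
have E_basis : is_basis (fun i => E i p).
  by have -> : (fun i => E i p) = e by apply/funext.
pose w := invmx (gram g (fun i => E i p)).
pose O := Omega p; pose A := phi p O.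
have contractE u v : contract w (fun i j => g p u (E i p) * g p v (E j p)) =
    g p u v.
  apply: (contract_gram (B := @metric_at _ _ _ g p)) E_basis _ _.
  - exact: metric_linear.
  - exact: Defs.metric_sym.
  - exact: metric_nondegenerate.
have etaE v : eta p v = g p (xi p) v.
  by rewrite (eta_metric hcontact hnorden) Defs.metric_sym.
have xiO : g p (xi p) O = 0 := metric_xi_Omega hcontact hF11 hOmega p.
have xixi : g p (xi p) (xi p) = 1 := metric_xi hcontact hnorden p.
have xiA : g p (xi p) A = 0 by rewrite -etaE (eta_phi hcontact).
have AA : g p A A = - g p O O by rewrite hnorden etaE xiO mulr0 addr0.
have covE X Y : cov_form D eta X Y p = g p (xi p) (X p) * g p A (Y p).
  rewrite (cov_form_F11 hcontact hnorden hLC hF11 hOmega E_basis) etaE.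
  by rewrite (Defs.metric_sym g (Y p)).
have DetaE : sqnorm_form g p E (cov_form D eta) = - g p O O.
  transitivity (contract4 w (fun i j k s =>
    (g p (xi p) (E i p) * g p (xi p) (E j p)) *
    (g p A (E k p) * g p A (E s p)))).
    by apply: eq_contract4 => i j k s; rewrite !covE mulrACA.
  by rewrite contract4M !contractE xixi AA mul1r.
have NE : sqnorm_vec g p E (nijenhuis phi xi eta D) = - (2 * g p O O).
  transitivity (contract4 w (fun i j k s =>
    (g p (xi p) (E i p) * g p (xi p) (E j p)) *
      (g p A (E k p) * g p A (E s p)) +
    (-1 * (g p (xi p) (E i p) * g p A (E j p))) *
      (g p A (E k p) * g p (xi p) (E s p)) +
    (-1 * (g p A (E i p) * g p (xi p) (E j p))) *
      (g p (xi p) (E k p) * g p A (E s p)) +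
    (g p A (E i p) * g p A (E j p)) *
      (g p (xi p) (E k p) * g p (xi p) (E s p)))).
    (* The four terms expand (eta_i alpha_k - eta_k alpha_i) times
       (eta_j alpha_s - eta_s alpha_j), sorted by the index pairs (i, j) and
       (k, s) that the inverse Gram matrices contract; the two mixed terms
       contract to g xi (phi Omega) = 0. *)
    apply: eq_contract4 => i j k s.
    rewrite !(nijenhuis_F11 hcontact hnorden hLC hF11 hOmega E_basis) !covE.
    rewrite metricZl metricZr xixi; ring.
  rewrite !contract4D !contract4M !contractZ !contractE.
  rewrite (Defs.metric_sym g A) xixi xiA AA; ring.
have DphiE : sqnorm_vec g p E (cov_endo D phi) = 2 * g p O O.
  transitivity (contract4 w (fun i j k s =>
    (g p O O * (g p (xi p) (E i p) * g p (xi p) (E j p))) *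
      (g p (xi p) (E k p) * g p (xi p) (E s p)) +
    (g p (xi p) (E i p) * g p (xi p) (E j p)) *
      (g p O (E k p) * g p O (E s p)))).
    apply: eq_contract4 => i j k s.
    rewrite !(cov_endo_F11 hcontact hnorden hF11 hOmega E_basis) -/O !etaE.
    rewrite !(metricZl, metricZr, metricDl, metricDr) xixi.
    rewrite (Defs.metric_sym g O (xi p)) xiO !(Defs.metric_sym g O (E _ p)); ring.
  rewrite contract4D !contract4M contractZ !contractE xixi; ring.
move=> norm_Dphi norm_N norm_Deta; rewrite /norm_Dphi /norm_N /norm_Deta.
by rewrite DphiE NE DetaE (omegaE hOmega) opprK mulrN opprK.
Qed.
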